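(* Let $\tau\ge0$ and $\lambda:=\tau/\varepsilon$ with $0\le\lambda\le1$, and let $(u_n)_{n\ge0}$ be a sequence given by the semi-discrete scheme with time step $\tau$ and some initial condition $u_0\in\mathcal V_{[0,1]}$. Then $$\sum_{n=0}^\infty\|u_{n+1}-u_n\|_{\mathcal V}^2<\infty,$$ and therefore in particular $\lim_{n\to\infty}\|u_{n+1}-u_n\|_{\mathcal V}=0$.
   Context: Let $G=(V,E)$ be a finite, undirected, simple, connected graph with symmetric weights $\omega_{ij}=\omega_{ji}$, $\omega_{ij}>0$ for $ij\in E$ and $\omega_{ij}=0$ for $ij\notin E$. Let $d_i=\sum_{j}\omega_{ij}>0$ be the degree of $i\in V$. Fix $r\in[0,1]$ and $\varepsilon>0$. Let $\mathcal V=\{u:V\to\mathbb R\}$ and, for $X\subseteq\mathbb R$, $\mathcal V_X=\{u:V\to X\}$; $\mathcal V$ carries the inner product $\langle u,v\rangle_{\mathcal V}=\sum_{i\in V}u_iv_id_i^r$ with norm $\|\cdot\|_{\mathcal V}$. $\mathbf 1\in\mathcal V$ is the constant function $1$. The graph Laplacian is $(\Delta u)_i=d_i^{-r}\sum_{j\in V}\omega_{ij}(u_i-u_j)$, and $e^{-t\Delta}=\sum_{n\ge0}\frac{(-1)^nt^n}{n!}\Delta^n$. For $u\in\mathcal V_{[0,1]}$, $\mathcal B(u)$ is the set of $\alpha\in\mathcal V$ such that for each $i\in V$: $\alpha_i\ge0$ if $u_i=0$, $\alpha_i=0$ if $0<u_i<1$, and $\alpha_i\le0$ if $u_i=1$.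 Semi-discrete scheme (time step $\tau$, $\lambda=\tau/\varepsilon$): a sequence with $u_n\in\mathcal V_{[0,1]}$ such that for every $n\ge0$ there is $\beta_{n+1}\in\mathcal B(u_{n+1})$ with $(1-\lambda)u_{n+1}-e^{-\tau\Delta}u_n+\frac\lambda2\mathbf 1=\lambda\beta_{n+1}$. *)

(* Defs.v *)
From HB Require Import structures.
From mathcomp Require Import all_boot all_order all_algebra.
From mathcomp Require Import all_classical all_reals all_analysis.

Set Implicit Arguments.
Unset Strict Implicit.
Unset Printing Implicit Defensive.

Import Order.TTheory GRing.Theory Num.Theory.
Import numFieldNormedType.Exports.

Local Open Scope classical_set_scope.
Local Open Scope ring_scope.

Record weightedGraph (R : realType) := WeightedGraph {
  vertex : finType;
  edge : rel vertex;
  edge_sym : symmetric edge;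
  edge_irr : irreflexive edge;
  edge_connected : forall i j, connect edge i j;
  weight : vertex -> vertex -> R;
  weight_sym : forall i j, weight i j = weight j i;
  weight_gt0 : forall i j, edge i j -> 0 < weight i j;
  weight_eq0 : forall i j, ~~ edge i j -> weight i j = 0;
  (* Excludes the one-vertex graph. *)
  sum_weight_gt0 : forall i, 0 < \sum_j weight i j
}.

Section Graph.
Variables (R : realType) (G : weightedGraph R) (r : R).
Local Notation V := (vertex G).
Implicit Types (u v : V -> R) (i : V).

Definition degree i : R := \sum_j weight i j.

Definition funs_in (X : set R) : set (V -> R) :=
  [set u | forall i, X (u i)].

Definition graph_inner u v : R := \sum_i u i * v i * degree i `^ r.

Definition graph_norm u : R := Num.sqrt (graph_inner u u).

Definition laplacian u : V -> R :=
  fun i => degree i `^ (- r) * \sum_j weight i j * (u i - u j).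

(* [exp_laplacian t] is the operator e^{-t Delta}; as V is finite, the operator
   series may be summed entrywise. See [is_cvg_exp_laplacian] for the
   convergence of the series whose limit is taken. *)
Definition exp_laplacian (t : R) u : V -> R := fun i =>
  limn (series (fun n => (-1) ^+ n * t ^+ n / n`!%:R * iter n laplacian u i)).

Lemma laplacian_bound : exists2 C : R, 0 <= C &
  forall u M, (forall i, `|u i| <= M) -> forall i, `|laplacian u i| <= C * M.
Proof.
pose c i : R := degree i `^ (- r) * (\sum_j weight i j * 2).
have w0 i j : 0 <= weight i j :> R.
  by have [/weight_gt0/ltW//|/weight_eq0->] := boolP (edge i j).
have c0 i : 0 <= c i.
  by rewrite mulr_ge0 ?powR_ge0// sumr_ge0// => j _; rewrite mulr_ge0.
exists (\sum_i c i); first exact: sumr_ge0.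
move=> u M uM i.
have M0 : 0 <= M by rewrite (le_trans _ (uM i)).
rewrite (@le_trans _ _ (c i * M))//; last first.
  by rewrite ler_wpM2r// (bigD1 i)//= lerDl sumr_ge0.
rewrite /laplacian /c normrM ger0_norm ?powR_ge0// -mulrA ler_wpM2l ?powR_ge0//.
rewrite mulr_suml (le_trans (ler_norm_sum _ _ _))// ler_sum// => j _.
rewrite normrM ger0_norm// -mulrA ler_wpM2l// (le_trans (ler_normB _ _))//.
by rewrite mulr_natl mulr2n lerD.
Qed.

Lemma is_cvg_exp_laplacian (t : R) u i :
  cvgn (series (fun n => (-1) ^+ n * t ^+ n / n`!%:R * iter n laplacian u i)).
Proof.
have [C C0 lapC] := laplacian_bound.
pose M : R := \sum_j `|u j|.
have uM n : forall j, `|iter n laplacian u j| <= C ^+ n * M.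
  elim: n => [|n IHn] j /=.
    by rewrite expr0 mul1r /M (bigD1 j)//= lerDl sumr_ge0.
  by rewrite exprS -mulrA; exact: lapC.
apply: normed_cvg.
apply: (@series_le_cvg _ _ (fun n => M * exp_coeff (`|t| * C) n)).
- by move=> n; exact: normr_ge0.
- move=> n; rewrite mulr_ge0 ?sumr_ge0// /exp_coeff.
  by rewrite divr_ge0// exprn_ge0// mulr_ge0.
- move=> n /=; rewrite /exp_coeff !normrM normrX normrN1 expr1n mul1r normrX.
  rewrite normfV normr_nat.
  apply: (@le_trans _ _ (`|t| ^+ n / n`!%:R * (C ^+ n * M))).
    by rewrite ler_wpM2l// divr_ge0// exprn_ge0.
  by rewrite /= exprMn [leRHS]mulrC -!mulrA (mulrCA _ (C ^+ n)).
- by apply: is_cvg_seriesZ; exact: is_cvg_series_exp_coeff.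
Qed.

(* The set B(u); it is only used for u with values in [0, 1]. *)
Definition obstacle_subdiff u : set (V -> R) :=
  [set a | forall i, [/\ u i = 0 -> 0 <= a i,
                         0 < u i < 1 -> a i = 0 &
                         u i = 1 -> a i <= 0]].

Definition semi_discrete_scheme (eps tau : R) (u : nat -> V -> R) : Prop :=
  let lambda := tau / eps in
  (forall n, funs_in [set` `[0, 1]] (u n)) /\
  forall n, exists2 b : V -> R, obstacle_subdiff (u n.+1) b &
    forall i, (1 - lambda) * u n.+1 i - exp_laplacian tau (u n) i + lambda / 2
              = lambda * b i.

End Graph.

(* Main.v *)
Require Import Defs.
From HB Require Import structures.
From mathcomp Require Import all_boot all_order all_algebra.
From mathcomp Require Import all_classical all_reals all_analysis.
From mathcomp Require Import ring lra.

Import Order.TTheory GRing.Theory Num.Theory.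
Import numFieldNormedType.Exports.

Local Open Scope classical_set_scope.
Local Open Scope ring_scope.

(** Write A = e^{-tau Delta} and lambda = tau / eps. The proof is an energy
    argument with the functional

      J(u) = lambda <u, 1 - u> + <u - A u, u>.

    Expanding J(u) - J(v) for two consecutive iterates u, v, and replacing A u
    by means of the scheme, gives, with beta the multiplier of that step,

      J(u) - J(v) = (1 - lambda) |v - u|^2 + <v - u, A (v - u)>
                      + 2 lambda <u - v, beta>.

    The last term is nonnegative because beta lies in B(v) and u takes its
    values in [0, 1] ([lyapunov_decrease]). The first term alone would bound
    |v - u|^2 only when lambda < 1; it is the second one that yields a bound
    which survives at lambda = 1, since A is coercive: |w|^2 <= K <w, A w>
    ([exp_laplacian_coercive]). As J is bounded below on functions with values
    in [0, 1] ([lyapunov_ge]), the decrements of J along the sequence telescope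
    to a finite quantity, so the squared increments are summable, hence tend
    to 0.

    Coercivity of A is derived from the evolution equation rather than from the
    spectrum of Delta. The function s |-> <A_s w, A_(t - s) z>, with
    A_s = e^{-s Delta}, has derivative 0 because Delta is symmetric and
    commutes with A_s ([exp_laplacian_semigroup]). Comparing its values at
    different s gives at once the symmetry of A_t, the identity
    <w, A_t w> = |A_(t/2) w|^2, and <A_s w, A_(-s) w> = |w|^2; the last one,
    together with the boundedness of A_(-s), bounds |A_s w| from below. *)

(** * Differentiation of finite sums *)

Lemma is_derive_bigsum (R : realType) (I : finType) (h : I -> R -> R)
    (dh : I -> R) (x : R) :
  (forall i, is_derive x 1 (h i) (dh i)) ->
  is_derive x 1 (fun s => \sum_i h i s) (\sum_i dh i).
Proof.
move=> hd; elim: (index_enum I) => [|i e IH].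
  rewrite big_nil; under eq_fun do rewrite big_nil; exact: is_derive_cst.
rewrite big_cons; under eq_fun do rewrite big_cons.
exact: (@is_deriveD _ _ _ (h i) (fun s => \sum_(j <- e) h j s)).
Qed.

(** * Symmetry of the graph Laplacian *)

Section Semigroup.
Variables (R : realType) (G : weightedGraph R) (r : R).
Implicit Types (u v w z : vertex G -> R) (i : vertex G) (s t : R).

Local Notation Delta := (laplacian r).
Local Notation heat := (exp_laplacian r).
Local Notation "<[ u , v ]>" := (graph_inner r u v).

Lemma degree_powR_gt0 i : 0 < degree i `^ r.
Proof. exact/powR_gt0/sum_weight_gt0. Qed.

Lemma graph_innerC u v : <[u, v]> = <[v, u]>.
Proof. by apply: eq_bigr => i _; rewrite (mulrC (u i)). Qed.

Lemma graph_inner_ge0 u : 0 <= <[u, u]>.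
Proof.
by apply: sumr_ge0 => i _; rewrite mulr_ge0 ?powR_ge0// -expr2 sqr_ge0.
Qed.

Lemma graph_norm_sqr u : graph_norm r u ^+ 2 = <[u, u]>.
Proof. by rewrite sqr_sqrtr// graph_inner_ge0. Qed.

Lemma laplacianB u v : Delta (u \- v) = Delta u \- Delta v.
Proof.
apply/funext => i; rewrite /laplacian /= -mulrBr -sumrB; congr (_ * _).
by apply: eq_bigr => j _; ring.
Qed.

(** The factor d_i^{-r} of the Laplacian cancels the weight d_i^r of the inner
    product; what remains is a double sum with the symmetric kernel
    [weight i j]. *)
Lemma laplacian_sym u v : <[Delta u, v]> = <[u, Delta v]>.
Proof.
have inner_laplacian w z :
    <[Delta w, z]> = \sum_i \sum_j weight i j * (w i - w j) * z i.
  apply: eq_bigr => i _; rewrite /laplacian powRN.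
  rewrite -mulr_suml; field.
  by rewrite gt_eqF ?degree_powR_gt0.
have eqS w z : <[Delta w, z]> =
    \sum_i \sum_j weight i j * w i * z i - \sum_i \sum_j weight i j * w j * z i.
  rewrite inner_laplacian -sumrB; apply: eq_bigr => i _.
  by rewrite -sumrB; apply: eq_bigr => j _; ring.
rewrite (graph_innerC u) !eqS; congr (_ - _).
  by apply: eq_bigr => i _; apply: eq_bigr => j _; ring.
rewrite exchange_big; apply: eq_bigr => i _; apply: eq_bigr => j _.
by rewrite weight_sym; ring.
Qed.

(** * The semigroup generated by the Laplacian *)

Lemma iter_laplacianB n u v :
  iter n Delta (u \- v) = iter n Delta u \- iter n Delta v.
Proof. by elim: n => //= n ->; rewrite laplacianB. Qed.

Let sgterm t u i n : R := (-1) ^+ n * t ^+ n / n`!%:R * iter n Delta u i.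

Lemma exp_laplacian_cvg t u i :
  series (sgterm t u i) n @[n --> \oo] --> heat t u i.
Proof. exact: is_cvg_exp_laplacian. Qed.

Lemma exp_laplacianB t u v : heat t (u \- v) = heat t u \- heat t v.
Proof.
apply/funext => i /=; apply/cvg_lim => //.
rewrite (_ : series _ = series (sgterm t u i) \- series (sgterm t v i)).
  exact: cvgB (exp_laplacian_cvg _ _ _) (exp_laplacian_cvg _ _ _).
apply/funext => n; rewrite /series /= -sumrB; apply: eq_bigr => k _.
by rewrite iter_laplacianB /= /sgterm; ring.
Qed.

Lemma exp_laplacian0 u : heat 0 u = u.
Proof.
apply/funext => i; apply/cvg_lim => //; rewrite -cvg_shiftS /=.
rewrite (_ : (fun n => _) = cst (u i)); first exact: cvg_cst.
apply/funext => n; rewrite /series /= big_nat_recl//= big1_seq => [|k _].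
  by rewrite !expr0 fact0 !mul1r invr1 mul1r addr0.
by rewrite expr0n mulr0 !mul0r.
Qed.

Lemma laplacian_exp t u : Delta (heat t u) = heat t (Delta u).
Proof.
apply/esym/funext => i; apply/cvg_lim => //.
rewrite (_ : series _ = fun n => Delta (fun j => series (sgterm t u j) n) i).
  apply: cvgMr; apply: cvg_big => [|j _]; first exact: add_continuous.
  by apply: cvgMr; apply: cvgB; exact: exp_laplacian_cvg.
apply/funext => n; rewrite /laplacian /series /= -/(laplacian r).
under eq_bigr do rewrite -iterSr iterS /laplacian.
rewrite (eq_bigr (fun k => \sum_j degree i `^ (- r) * (weight i j *
  (sgterm t u i k - sgterm t u j k)))) => [|k _]; last first.
  by rewrite mulrCA !mulr_sumr; apply: eq_bigr => j _; rewrite /sgterm; ring.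
rewrite exchange_big mulr_sumr; apply: eq_bigr => j _.
by rewrite -sumrB !mulr_sumr.
Qed.

(** At a fixed vertex, t |-> e^{-t Delta} u is a power series in t, and shifting
    its coefficients as term-by-term differentiation does amounts to replacing
    u by - Delta u. *)
Lemma is_derive_exp_laplacian t u i :
  is_derive t 1 (fun s => heat s u i) (- heat t (Delta u) i).
Proof.
pose c u n : R := (-1) ^+ n / n`!%:R * iter n Delta u i.
have cE v s : pseries (c v) s = series (sgterm s v i).
  by apply/funext => n; apply: eq_bigr => k _; rewrite /c /sgterm /=; ring.
have cvgc v s : cvgn (pseries (c v) s).
  by rewrite cE; exact: is_cvg_exp_laplacian.
have dc v : pseries_diffs (c v) = \- c (Delta v).
  apply/funext => n; rewrite /pseries_diffs /c /= -iterSr factS natrM exprS.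
  rewrite /=; field.
  by rewrite nat1r !pnatr_eq0 -!lt0n fact_gt0.
have dN (f : nat -> R) : pseries_diffs (\- f) = \- pseries_diffs f.
  by apply/funext => n; rewrite /pseries_diffs /= mulrN.
have pN (f : nat -> R) s : pseries (\- f) s = \- pseries f s.
  apply/funext => n; rewrite /pseries /series /= -sumrN.
  by apply: eq_bigr => k _; rewrite mulNr.
(* The series converge everywhere; |t| + 1 is just a point beyond |t|. *)
have := @pseries_snd_diffs R (c u) (`|t| + 1) t (cvgc _ _).
rewrite dc dN dc pN (_ : \- \- _ = c (Delta (Delta u))); last first.
  by apply/funext => n /=; rewrite opprK.
rewrite !pN => /(_ (is_cvgN (cvgc _ _)) (cvgc _ _)).
rewrite limN; last exact: cvgc.
rewrite cE [ltRHS]ger0_norm ?addr_ge0// ltrDl ltr01 => /(_ isT).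
by under eq_fun do rewrite cE.
Qed.

(** In the sup norm, |Delta^n u| <= C^n |u| bounds the terms of the series by
    those of the exponential series of |t| C. *)
Lemma exp_laplacian_bound t : exists2 K : R, 0 < K &
  forall u M, (forall i, `|u i| <= M) -> forall i, `|heat t u i| <= K * M.
Proof.
have [C C0 lapC] := laplacian_bound G r.
exists (expR (`|t| * C)); first exact: expR_gt0.
move=> u M uM i.
have iterM n : forall j, `|iter n Delta u j| <= C ^+ n * M.
  elim: n => [|n IHn] j /=; first by rewrite expr0 mul1r.
  by rewrite exprS -mulrA; exact: lapC.
have M0 : 0 <= M by rewrite (le_trans _ (uM i)).
have termM n : `|sgterm t u i n| <= M * exp_coeff (`|t| * C) n.
  rewrite /sgterm /exp_coeff /= !normrM !normrX normrN1 expr1n mul1r.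
  rewrite normfV normr_nat exprMn.
  have -> : M * (`|t| ^+ n * C ^+ n / n`!%:R) =
      `|t| ^+ n / n`!%:R * (C ^+ n * M) by ring.
  by rewrite ler_wpM2l// divr_ge0// exprn_ge0.
rewrite -(cvg_lim _ (cvg_norm (exp_laplacian_cvg t u i)))//.
apply: limr_le.
  by apply: is_cvg_norm; exact: is_cvg_exp_laplacian.
apply: nearW => n; rewrite (le_trans (ler_norm_sum _ _ _))//.
apply: (@le_trans _ _ (M * series (exp_coeff (`|t| * C)) n)).
  by rewrite /series /= mulr_sumr ler_sum.
rewrite mulrC ler_wpM2r//.
apply: nondecreasing_cvgn_le; last exact: is_cvg_series_exp_coeff.
apply/nondecreasing_series => k _ _.
by rewrite divr_ge0// exprn_ge0// mulr_ge0.
Qed.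

(** The left-hand side is constant in s: its derivative is
    - <A_s (Delta w), A_(t - s) z> + <A_s w, A_(t - s) (Delta z)>, which vanishes
    once Delta is moved out of both semigroup operators and across the inner
    product. The value at s = 0 is the right-hand side. This is the semigroup
    law in weak form, obtained without multiplying power series. *)
Lemma exp_laplacian_semigroup s t w z :
  <[heat s w, heat (t - s) z]> = <[w, heat t z]>.
Proof.
pose F s := <[heat s w, heat (t - s) z]>.
suff F0 (x : R) : is_derive x 1 F 0.
  by rewrite -[LHS]/(F s) (is_derive_0_is_cst s 0 F0) /F exp_laplacian0 subr0.
pose dF i := (- heat x (Delta w) i * heat (t - x) z i +
  heat x w i * heat (t - x) (Delta z) i) * degree i `^ r.
have -> : 0 = \sum_i dF i.
  apply/esym/eqP; rewrite /dF.
  under eq_bigr do rewrite mulNr mulrDl mulNr addrC.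
  rewrite sumrB subr_eq0; apply/eqP.
  rewrite -!laplacian_exp; exact/esym/laplacian_sym.
apply: is_derive_bigsum => i.
have hw := is_derive_exp_laplacian x w i.
have hz := is_derive_exp_laplacian (t - x) z i.
have hx : is_derive x 1 (fun s : R => t - s) (-1).
  apply: (is_derive_eq (is_deriveB (is_derive_cst t x 1) (is_derive_id x 1))).
  by rewrite sub0r.
have hc := @is_derive1_comp _ _ (fun s : R => t - s) _ _ _ hz hx.
have hm := @is_deriveM _ _ _ _ _ _ _ _ hw hc.
have hd := @is_deriveM _ _ _ _ _ _ _ _ hm (is_derive_cst (degree i `^ r) x 1).
by apply: (is_derive_eq hd); rewrite /dF /= !scaler0 add0r /GRing.scale /=; ring.
Qed.

Lemma exp_laplacian_sym t u v : <[heat t u, v]> = <[u, heat t v]>.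
Proof. by rewrite -(exp_laplacian_semigroup t) subrr exp_laplacian0. Qed.

Lemma exp_laplacian_inner_half t w :
  <[w, heat t w]> = <[heat (t / 2) w, heat (t / 2) w]>.
Proof.
by rewrite -(exp_laplacian_semigroup (t / 2)) (_ : t - t / 2 = t / 2)//; field.
Qed.

(** * Coercivity of the semigroup operators *)

(** This transports [exp_laplacian_bound] to the norm of the inner product, all
    norms on a finite-dimensional space being equivalent. *)
Lemma exp_laplacian_inner_bound t : exists2 K : R, 0 < K &
  forall u, <[heat t u, heat t u]> <= K * <[u, u]>.
Proof.
have [K K0 heatK] := exp_laplacian_bound t.
pose m i : R := degree i `^ r.
pose D := \sum_i (m i)^-1; pose S := \sum_i m i.
have m0 i : 0 < m i := degree_powR_gt0 i.
have D0 : 0 <= D by apply: sumr_ge0 => i _; rewrite invr_ge0 ltW.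
have S0 : 0 <= S by apply: sumr_ge0 => i _; rewrite ltW.
exists (K ^+ 2 * D * S + 1) => [|u].
  (* The added 1 makes the constant positive even on the empty vertex set. *)
  by rewrite ltr_wpDl// mulr_ge0// mulr_ge0// sqr_ge0.
have u0 := graph_inner_ge0 u.
have uD i : `|u i| <= Num.sqrt (D * <[u, u]>).
  rewrite -sqrtr_sqr ler_wsqrtr//.
  apply: (@le_trans _ _ ((m i)^-1 * <[u, u]>)).
    rewrite -ler_pdivrMl ?invr_gt0// invrK /graph_inner (bigD1 i)//= mulrC.
    rewrite -expr2 lerDl sumr_ge0// => j _.
    by rewrite mulr_ge0 ?powR_ge0// -expr2 sqr_ge0.
  rewrite ler_wpM2r// /D (bigD1 i)//= lerDl sumr_ge0// => j _.
  by rewrite invr_ge0 ltW.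
apply: (@le_trans _ _ (K ^+ 2 * D * S * <[u, u]>)); last first.
  by rewrite ler_wpM2r// lerDl.
have -> : K ^+ 2 * D * S * <[u, u]> =
    \sum_i K ^+ 2 * (D * <[u, u]>) * m i by rewrite -mulr_sumr -/S; ring.
apply: ler_sum => i _; rewrite ler_wpM2r ?(ltW (m0 i))//.
rewrite -expr2 -real_normK ?num_real//.
rewrite -(@sqr_sqrtr _ (D * <[u, u]>)) ?mulr_ge0// -exprMn.
by rewrite lerXn2r ?nnegrE ?normr_ge0 ?mulr_ge0 ?sqrtr_ge0 ?(ltW K0)// heatK.
Qed.

(** With p = A_(t/2) w and q = A_(-t/2) w one has <p, q> = |w|^2, whereas
    |q|^2 <= K |w|^2. Young's inequality 2 <p, q> <= K |p|^2 + K^-1 |q|^2 then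
    gives 2 |w|^2 <= K |p|^2 + |w|^2, and |p|^2 = <w, A_t w>. *)
Lemma exp_laplacian_coercive t : exists2 K : R, 0 < K &
  forall w, <[w, w]> <= K * <[w, heat t w]>.
Proof.
have [K K0 heatK] := exp_laplacian_inner_bound (- (t / 2)).
exists K => // w; rewrite exp_laplacian_inner_half.
set p := heat (t / 2) w; pose q := heat (- (t / 2)) w.
have young : 2 * <[p, q]> <= K * <[p, p]> + K^-1 * <[q, q]>.
  rewrite !mulr_sumr -big_split; apply: ler_sum => i _ /=.
  rewrite !mulrA -mulrDl ler_wpM2r ?powR_ge0// -subr_ge0.
  have -> : K * p i * p i + K^-1 * q i * q i - 2 * p i * q i =
      K^-1 * (K * p i - q i) ^+ 2 by field; rewrite gt_eqF.
  by rewrite mulr_ge0 ?sqr_ge0// invr_ge0 ltW.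
have pq : <[p, q]> = <[w, w]>.
  have := exp_laplacian_semigroup (t / 2) 0 w w.
  by rewrite sub0r exp_laplacian0.
have qK : K^-1 * <[q, q]> <= <[w, w]> by rewrite ler_pdivrMl// heatK.
by rewrite pq in young; lra.
Qed.

(** * The Lyapunov functional of the scheme *)

(** This is lambda <u, 1 - u> + <u - e^{-tau Delta} u, u>, written as a single
    sum so that it can be estimated vertex by vertex. *)
Definition lyapunov (lam tau : R) u : R :=
  \sum_i (lam * u i * (1 - u i) + (u i - heat tau u i) * u i) * degree i `^ r.

(** The difference of the two sides is
    (1 - lambda) |v - u|^2 + 2 lambda <b, u - v>. The obstacle condition makes
    each b_i (u_i - v_i) nonnegative: b_i points inwards where v_i is 0 or 1,
    and vanishes elsewhere. *)
Lemma lyapunov_decrease (lam tau : R) u v b :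
  0 <= lam <= 1 -> (forall i, 0 <= u i <= 1) -> (forall i, 0 <= v i <= 1) ->
  obstacle_subdiff v b ->
  (forall i, (1 - lam) * v i - heat tau u i + lam / 2 = lam * b i) ->
  <[v \- u, heat tau (v \- u)]> <= lyapunov lam tau u - lyapunov lam tau v.
Proof.
move=> /andP[lam0 lam1] u01 v01 vb scheme.
have sym : <[v, heat tau u]> = <[u, heat tau v]>.
  by rewrite -exp_laplacian_sym graph_innerC.
rewrite exp_laplacianB.
pose m i : R := degree i `^ r.
rewrite -subr_ge0.
(* The identity holds vertex by vertex only after u_i (A v)_i is traded for
   v_i (A u)_i, since the scheme determines A u and not A v; the bracket at the
   end records this exchange and vanishes by symmetry of A. *)
have -> : lyapunov lam tau u - lyapunov lam tau v -
    <[v \- u, heat tau v \- heat tau u]> =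
    \sum_i ((1 - lam) * (v i - u i) ^+ 2 + 2 * lam * (b i * (u i - v i))) * m i
    + (<[u, heat tau v]> - <[v, heat tau u]>).
  rewrite /lyapunov /graph_inner -!sumrB -big_split; apply: eq_bigr => i _ /=.
  have -> : heat tau u i = (1 - lam) * v i + lam / 2 - lam * b i.
    by rewrite -scheme; ring.
  by rewrite -/(m i); field.
rewrite sym subrr addr0 sumr_ge0// => i _; rewrite mulr_ge0 ?powR_ge0//.
apply: addr_ge0; first by rewrite mulr_ge0 ?subr_ge0 ?sqr_ge0.
apply: mulr_ge0; first by rewrite mulr_ge0.
have [b0 b01 b1] := vb i.
have /andP[ui0 ui1] := u01 i; have /andP[vi0 vi1] := v01 i.
have [/eqP v0|v0] := boolP (v i == 0).
  by rewrite v0 subr0 mulr_ge0 ?b0.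
have [/eqP v1|v1] := boolP (v i == 1).
  by rewrite mulr_le0 ?b1// v1 subr_le0.
by rewrite b01 ?mul0r// lt_def v0 vi0 lt_neqAle v1.
Qed.

(** On functions with values in [0, 1] the only term without a sign is
    - <A u, u>, and A u is bounded uniformly there. *)
Lemma lyapunov_ge (lam tau : R) : 0 <= lam -> exists K : R,
  forall u, (forall i, 0 <= u i <= 1) -> K <= lyapunov lam tau u.
Proof.
move=> lam0; have [K K0 heatK] := exp_laplacian_bound tau.
exists (\sum_(i : vertex G) - K * degree i `^ r) => u u01; apply: ler_sum => i _.
rewrite ler_wpM2r ?powR_ge0//.
have /andP[ui0 ui1] := u01 i.
have /ler_normlP[_ hK] : `|heat tau u i| <= K.
  rewrite -[leRHS]mulr1; apply: heatK => j.
  by have /andP[uj0 uj1] := u01 j; rewrite ger0_norm.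
have : 0 <= lam * u i * (1 - u i) by rewrite !mulr_ge0// subr_ge0.
have : 0 <= (K - heat tau u i) * u i by rewrite mulr_ge0// subr_ge0.
have : 0 <= K * (1 - u i) by rewrite mulr_ge0 ?subr_ge0// ltW.
have := sqr_ge0 (u i); nra.
Qed.

End Semigroup.

(** * Summability of the increments *)

Lemma bounded_series_summable (R : realType) (a : nat -> R) (B : R) :
  (forall n, 0 <= a n) -> (forall N, \sum_(0 <= n < N) a n <= B) ->
  (\sum_(0 <= n <oo) (a n)%:E < +oo)%E /\ a n @[n --> \oo] --> 0.
Proof.
move=> a0 aB; split.
  apply: (@le_lt_trans _ _ B%:E); last exact: ltry.
  apply: lime_le; first by apply: is_cvg_nneseries => n _ _; rewrite lee_fin.
  by apply: nearW => N; rewrite sumEFin lee_fin.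
apply: cvg_series_cvg_0; apply: nondecreasing_is_cvgn.
  by apply/nondecreasing_series => k _ _.
by exists B => _ [N _ <-]; exact: aB.
Qed.

Theorem corollary4p6 (R : realType) (G : weightedGraph R) (r eps tau : R)
    (u : nat -> vertex G -> R)
    (hr : 0 <= r <= 1) (heps : 0 < eps) (htau : 0 <= tau)
    (hlambda : 0 <= tau / eps <= 1)
    (hu : semi_discrete_scheme r eps tau u) :
  (\sum_(0 <= n <oo) (graph_norm r (u n.+1 \- u n) ^+ 2)%:E < +oo)%E /\
  graph_norm r (u n.+1 \- u n) @[n --> \oo] --> (0 : R).
Proof.
case: hu => u01 scheme.
have {}u01 n i : 0 <= u n i <= 1.
  by have := u01 n i; rewrite /= in_itv.
have [K K0 coercive] := exp_laplacian_coercive R G r tau.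
pose J := lyapunov R G r (tau / eps) tau.
have [L JL] : exists L, forall v, (forall i, 0 <= v i <= 1) -> L <= J v.
  by apply: lyapunov_ge; case/andP: hlambda.
have step n : graph_norm r (u n.+1 \- u n) ^+ 2 <= K * (J (u n) - J (u n.+1)).
  have [b ub ueq] := scheme n.
  rewrite graph_norm_sqr (le_trans (coercive _))// ler_pM2l//.
  exact: (lyapunov_decrease _ _ _ _ _ _ _ _ hlambda (u01 n) (u01 n.+1) ub).
have partial N :
    \sum_(0 <= n < N) graph_norm r (u n.+1 \- u n) ^+ 2 <= K * (J (u 0%N) - L).
  apply: (@le_trans _ _ (K * (J (u 0%N) - J (u N)))); last first.
    by rewrite ler_pM2l// lerB// JL.
  have -> : J (u 0%N) - J (u N) = \sum_(0 <= n < N) (J (u n) - J (u n.+1)).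
    by rewrite (telescope_sumr_eq (fun n => - J (u n)))// => [|n _]; ring.
  by rewrite mulr_sumr ler_sum.
have [summable sqr_cvg] :=
  bounded_series_summable _ _ _ (fun n => sqr_ge0 _) partial.
split=> //.
rewrite -[X in _ --> X](sqrtr0 R).
rewrite (_ : (fun n => _) =
    (fun n => Num.sqrt (graph_norm r (u n.+1 \- u n) ^+ 2))); last first.
  by apply/funext => n; rewrite sqrtr_sqr ger0_norm ?sqrtr_ge0.
exact: (cvg_comp _ _ sqr_cvg (@sqrt_continuous R 0)).
Qed.
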